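(* Let $1\to N\xrightarrow{i}G\xrightarrow{p}\Gamma\to1$ be an exact sequence of groups and $V$ a left Banach $\mathbb{R}[\Gamma]$-module equipped with a $\Gamma$-invariant norm $\|\cdot\|$. Then there exists an exact sequence \[ 0\to\mathrm{H}^1_{/b}(\Gamma;V)\xrightarrow{p^*}\mathrm{H}^1_{/b}(G;V)\xrightarrow{i^*}\mathrm{H}^1_{/b}(N;V)^G\xrightarrow{\tau_{/b}}\mathrm{H}^2_{/b}(\Gamma;V)\xrightarrow{p^*}\mathrm{H}^2_{/b}(G;V). \] Moreover, this exact sequence is compatible with the five-term exact sequence of group cohomology \[ 0\to\mathrm{H}^1(\Gamma;V)\xrightarrow{p^*}\mathrm{H}^1(G;V)\xrightarrow{i^*}\mathrm{H}^1(N;V)^G\xrightarrow{\tau}\mathrm{H}^2(\Gamma;V)\xrightarrow{p^*}\mathrm{H}^2(G;V), \] that is, the ladder diagram from the second sequence to the first one commutes, where the vertical maps $\xi_1\colon\mathrm{H}^1(\Gamma;V)\to\mathrm{H}^1_{/b}(\Gamma;V)$, $\xi_2\colon\mathrm{H}^1(G;V)\to\mathrm{H}^1_{/b}(G;V)$, $\xi_3\colon\mathrm{H}^1(N;V)^G\to\mathrm{H}^1_{/b}(N;V)^G$, $\xi_4\colon\mathrm{H}^2(\Gamma;V)\to\mathrm{H}^2_{/b}(\Gamma;V)$, $\xi_5\colon\mathrm{H}^2(G;V)\to\mathrm{H}^2_{/b}(G;V)$ are induced by the quotient map $C^\bullet\to C^\bullet_{/b}$.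
   Context: For a group $G$ and a left $\mathbb{R}[G]$-module $V$, $C^n(G;V)$ is the space of functions $G^{\times n}\to V$, with differential \[(\delta f)(g_0,\dots,g_n)=g_0\cdot f(g_1,\dots,g_n)+\sum_{j=1}^n(-1)^jf(g_0,\dots,g_{j-1}g_j,\dots,g_n)+(-1)^{n+1}f(g_0,\dots,g_{n-1});\] its cohomology is $\mathrm{H}^\bullet(G;V)$. If $V$ has a $G$-invariant norm, $C^\bullet_b(G;V)$ is the subcomplex of bounded functions, $C^\bullet_{/b}(G;V)=C^\bullet(G;V)/C^\bullet_b(G;V)$ is the quotient complex, and $\mathrm{H}^\bullet_{/b}(G;V)$ is its cohomology. A $\Gamma$-module $V$ is regarded as a $G$-module via $p$; thus $N$ acts trivially on $V$. $G$ acts on $C^n(N;V)$ by $({}^gf)(x_1,\dots,x_n)=g\cdot f(g^{-1}x_1g,\dots,g^{-1}x_ng)$; this induces $G$-actions on $\mathrm{H}^n(N;V)$ and $\mathrm{H}^n_{/b}(N;V)$, and the superscript $G$ denotes invariants. The map $\tau$ in the five-term exact sequence of group cohomology is: for $f\in\mathrm{H}^1(N;V)^G$ there is a map $F\colon G\to V$ with $F|_N=f$ and such that $\delta F=p^*\alpha_F$ for a $2$-cocycle $\alpha_F\in C^2(\Gamma;V)$; then $\tau(f)=[\alpha_F]$. *)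

(* Defs.v *)
From HB Require Import structures.
From mathcomp Require Import all_boot all_order all_algebra zify.
From mathcomp Require Import boolp classical_sets functions reals topology.
From mathcomp Require Import normedtype.

Set Implicit Arguments.
Unset Strict Implicit.
Unset Printing Implicit Defensive.

Import Order.TTheory GRing.Theory Num.Theory.
Import numFieldNormedType.Exports.

Local Open Scope classical_set_scope.
Local Open Scope ring_scope.
Local Open Scope quotient_scope.

(* Subspaces are Prop-valued so that they need no decidability; the boolean
   predicate required by the sub- and quotient-type constructions is
   recovered classically. *)
Record subspace (R : pzRingType) (V : lmodType R) := Subspace {
  subspace_set :> V -> Prop;
  subspace0 : subspace_set 0;
  subspaceP : forall a u v,
    subspace_set u -> subspace_set v -> subspace_set (a *: u + v)
}.

Section Subspaces.
Context {R : pzRingType} {V : lmodType R}.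
Implicit Types S : subspace V.

Definition mem_subspace S : {pred V} := fun x => `[< S x >].

Lemma mem_subspaceP S x : reflect (S x) (x \in mem_subspace S).
Proof. exact: asboolP. Qed.

Lemma mem_subspace_closed S : submod_closed (mem_subspace S).
Proof.
split; first by apply/mem_subspaceP; exact: subspace0.
move=> a u v /mem_subspaceP Su /mem_subspaceP Sv.
by apply/mem_subspaceP; exact: subspaceP.
Qed.

HB.instance Definition _ S :=
  GRing.isSubmodClosed.Build R V (mem_subspace S) (mem_subspace_closed S).

Definition subspace_type S : Type := {x : V | x \in mem_subspace S}.

HB.instance Definition _ S := SubChoice.on (subspace_type S).
HB.instance Definition _ S :=
  [SubChoice_isSubLmodule of subspace_type S by <:].

Lemma subspace_val S (x : subspace_type S) : S (val x).
Proof. exact/mem_subspaceP/(valP x). Qed.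

Definition to_subspace S x (Sx : S x) : subspace_type S :=
  Sub x (introT (mem_subspaceP S x) Sx).

Definition quotient_space S : Type := @Quotient.quot V (mem_subspace S).
HB.instance Definition _ S := GRing.Zmodule.on (quotient_space S).

Definition quotient_proj S (x : V) : quotient_space S := \pi x.

Lemma quotient_projP S x y :
  quotient_proj S x = quotient_proj S y <-> S (x - y).
Proof.
split=> [/eqP | Sxy]; first by rewrite -Quotient.idealrBE => /mem_subspaceP.
by apply/eqP; rewrite -Quotient.idealrBE; apply/mem_subspaceP.
Qed.

Lemma quotient_projK S (c : quotient_space S) : quotient_proj S (repr c) = c.
Proof. exact: reprK. Qed.

Lemma quotient_proj_repr S x : S (repr (quotient_proj S x) - x).
Proof. by apply/quotient_projP; rewrite quotient_projK. Qed.

Lemma quotient_projD S x y :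
  quotient_proj S (x + y) = quotient_proj S x + quotient_proj S y.
Proof. exact: (raddfD (\pi_(Quotient.quot (mem_subspace S)))). Qed.

Lemma subspaceZ S a x : S x -> S (a *: x).
Proof. by move=> Sx; rewrite -[a *: x]addr0; apply/subspaceP/subspace0. Qed.

Lemma subspaceD S x y : S x -> S y -> S (x + y).
Proof. by move=> Sx Sy; rewrite -[x]scale1r; apply/subspaceP. Qed.

Definition quotient_scale S a (c : quotient_space S) : quotient_space S :=
  quotient_proj S (a *: repr c).

Lemma quotient_proj_scale S a x :
  quotient_proj S (a *: x) = quotient_scale a (quotient_proj S x).
Proof.
apply/esym/quotient_projP; rewrite -scalerBr.
by apply/subspaceZ/quotient_proj_repr.
Qed.

Lemma quotient_scaleA S a b (c : quotient_space S) :
  quotient_scale a (quotient_scale b c) = quotient_scale (a * b) c.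
Proof. by rewrite -[c]quotient_projK -!quotient_proj_scale scalerA. Qed.

Lemma quotient_scale1 S : left_id 1 (@quotient_scale S).
Proof. by move=> c; rewrite -[c]quotient_projK -!quotient_proj_scale scale1r. Qed.

Lemma quotient_scaleDr S : right_distributive (@quotient_scale S) +%R.
Proof.
move=> a c d; rewrite -[c]quotient_projK -[d]quotient_projK.
rewrite -quotient_projD -!quotient_proj_scale scalerDr.
exact: quotient_projD.
Qed.

Lemma quotient_scaleDl S (c : quotient_space S) :
  {morph (@quotient_scale S)^~ c : a b / a + b}.
Proof.
move=> a b; rewrite -[c]quotient_projK -!quotient_proj_scale scalerDl.
exact: quotient_projD.
Qed.

HB.instance Definition _ S := GRing.Zmodule_isLmodule.Build R
  (quotient_space S) (@quotient_scaleA S) (@quotient_scale1 S)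
  (@quotient_scaleDr S) (@quotient_scaleDl S).

Lemma quotient_proj_is_linear S : linear (quotient_proj S).
Proof. by move=> a x y; rewrite quotient_projD quotient_proj_scale. Qed.

HB.instance Definition _ S :=
  GRing.isLinear.Build R V (quotient_space S) *:%R (quotient_proj S)
    (quotient_proj_is_linear S).

End Subspaces.

Section LinearMaps.
Context {R : pzRingType} {V W : lmodType R}.
Implicit Types (S : subspace V) (T : subspace W) (f : {linear V -> W}).

Lemma kernel_subproof f a u v : f u = 0 -> f v = 0 -> f (a *: u + v) = 0.
Proof. by move=> fu fv; rewrite linearP fu fv scaler0 addr0. Qed.

Definition kernel_subspace f : subspace V :=
  @Subspace R V (fun x => f x = 0) (linear0 f) (@kernel_subproof f).

Lemma image_subproof f a u v :
  (exists x, f x = u) -> (exists x, f x = v) -> exists x, f x = a *: u + v.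
Proof. by move=> [x <-] [y <-]; exists (a *: x + y); rewrite linearP. Qed.

Definition image_subspace f : subspace W :=
  @Subspace R W (fun y => exists x, f x = y)
    (ex_intro _ 0 (linear0 f)) (@image_subproof f).

Definition zero_subspace : subspace V.
Proof.
exists (fun x => x = 0) => // a u v -> ->.
by rewrite scaler0 addr0.
Defined.

Lemma preimage_subproof f T a u v :
  T (f u) -> T (f v) -> T (f (a *: u + v)).
Proof. by rewrite linearP; exact: subspaceP. Qed.

Definition preimage_subspace f T : subspace V.
Proof.
exists (fun x => T (f x)); first by rewrite linear0; exact: subspace0.
exact: preimage_subproof.
Defined.

Definition subspace_map f S T (fST : forall x, S x -> T (f x))
    (x : subspace_type S) : subspace_type T :=
  to_subspace (fST _ (subspace_val x)).

Lemma subspace_map_is_linear f S T (fST : forall x, S x -> T (f x)) :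
  linear (subspace_map fST).
Proof. by move=> a x y; apply: val_inj; rewrite /= linearP. Qed.

HB.instance Definition _ f S T (fST : forall x, S x -> T (f x)) :=
  GRing.isLinear.Build R (subspace_type S) (subspace_type T) *:%R
    (subspace_map fST) (subspace_map_is_linear fST).

Definition subspace_corestrict f T (fT : forall x, T (f x)) (x : V) :
  subspace_type T := to_subspace (fT x).

Lemma subspace_corestrict_is_linear f T (fT : forall x, T (f x)) :
  linear (subspace_corestrict fT).
Proof. by move=> a x y; apply: val_inj; rewrite /= linearP. Qed.

HB.instance Definition _ f T (fT : forall x, T (f x)) :=
  GRing.isLinear.Build R V (subspace_type T) *:%R
    (subspace_corestrict fT) (subspace_corestrict_is_linear fT).

(* The map V/S -> W/T induced by f; [quotient_mapE] is its characterization. *)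
Definition quotient_map f S T (fST : forall x, S x -> T (f x))
    (c : quotient_space S) : quotient_space T :=
  quotient_proj T (f (repr c)).

Lemma quotient_mapE f S T (fST : forall x, S x -> T (f x)) x :
  quotient_map fST (quotient_proj S x) = quotient_proj T (f x).
Proof.
by apply/quotient_projP; rewrite -linearB; apply/fST/quotient_proj_repr.
Qed.

Lemma quotient_map_is_linear f S T (fST : forall x, S x -> T (f x)) :
  linear (quotient_map fST).
Proof.
move=> a c d; rewrite -[c]quotient_projK -[d]quotient_projK -linearP.
by rewrite !quotient_mapE !linearP.
Qed.

HB.instance Definition _ f S T (fST : forall x, S x -> T (f x)) :=
  GRing.isLinear.Build R (quotient_space S) (quotient_space T) *:%R
    (quotient_map fST) (quotient_map_is_linear fST).

End LinearMaps.

Section Complexes.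
Variable R : pzRingType.

Record cochain_complex := Complex {
  cochains :> nat -> lmodType R;
  cdiff : forall n, {linear cochains n -> cochains n.+1};
  cdiffK : forall n x, cdiff n.+1 (cdiff n x) = 0
}.

Record subcomplex (C : cochain_complex) := Subcomplex {
  subcochains :> forall n, subspace (C n);
  subcochains_diff : forall n x,
    subcochains n x -> subcochains n.+1 (cdiff C n x)
}.

Record cochain_map (C D : cochain_complex) := ChainMap {
  cochain_fun :> forall n, {linear C n -> D n};
  cochain_map_diff : forall n x,
    cochain_fun n.+1 (cdiff C n x) = cdiff D n (cochain_fun n x)
}.

Definition cocycles (C : cochain_complex) n : subspace (C n) :=
  kernel_subspace (cdiff C n).

Definition coboundaries (C : cochain_complex) n : subspace (C n) :=
  match n with
  | 0 => zero_subspace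
  | m.+1 => image_subspace (cdiff C m)
  end.

Definition cocycle (C : cochain_complex) n : lmodType R :=
  subspace_type (cocycles C n).

Definition cocycle_coboundaries (C : cochain_complex) n :
    subspace (cocycle C n) :=
  preimage_subspace (\val : {linear cocycle C n -> C n}) (coboundaries C n).

Definition cohomology (C : cochain_complex) n : lmodType R :=
  quotient_space (cocycle_coboundaries C n).

Definition cohomology_class (C : cochain_complex) n (z : cocycle C n) :
  cohomology C n := quotient_proj (cocycle_coboundaries C n) z.

End Complexes.

Section Functoriality.
Context {R : pzRingType}.
Implicit Types C D : cochain_complex R.

Lemma cocycles_map C D (phi : cochain_map C D) n x :
  cocycles C n x -> cocycles D n (phi n x).
Proof. by move=> /= dx0; rewrite -cochain_map_diff dx0 linear0. Qed.

Definition cocycle_map C D (phi : cochain_map C D) n :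
    {linear cocycle C n -> cocycle D n} :=
  subspace_map (@cocycles_map C D phi n).

Lemma coboundaries_map C D (phi : cochain_map C D) n (z : cocycle C n) :
  cocycle_coboundaries C n z ->
  cocycle_coboundaries D n (cocycle_map phi n z).
Proof.
rewrite /cocycle_coboundaries; case: n z => [|n] z /=.
  by move=> ->; rewrite linear0.
by move=> [x <-]; exists (phi n x); rewrite cochain_map_diff.
Qed.

Definition cohomology_map C D (phi : cochain_map C D) n :
    {linear cohomology C n -> cohomology D n} :=
  quotient_map (@coboundaries_map C D phi n).

Lemma cohomology_mapE C D (phi : cochain_map C D) n (z : cocycle C n) :
  cohomology_map phi n (cohomology_class z) =
  cohomology_class (cocycle_map phi n z).
Proof. exact: quotient_mapE. Qed.

Lemma cohomology_classK C n (c : cohomology C n) :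
  exists z, c = cohomology_class z.
Proof. by exists (repr c); rewrite /cohomology_class quotient_projK. Qed.

Section QuotientComplex.
Context {C : cochain_complex R} (S : subcomplex C).

Definition quotient_diff n :
    {linear quotient_space (S n) -> quotient_space (S n.+1)} :=
  quotient_map (@subcochains_diff R C S n).

Lemma quotient_diffK n c : quotient_diff n.+1 (quotient_diff n c) = 0.
Proof.
rewrite -[c]quotient_projK /quotient_diff /= !quotient_mapE cdiffK.
exact: linear0.
Qed.

Definition quotient_complex : cochain_complex R := Complex quotient_diffK.

Lemma quotient_complex_proj_diff n (x : C n) :
  quotient_proj (S n.+1) (cdiff C n x) =
  cdiff quotient_complex n (quotient_proj (S n) x).
Proof. by rewrite /= quotient_mapE. Qed.

Definition quotient_complex_proj : cochain_map C quotient_complex :=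
  @ChainMap R C quotient_complex
    (fun n => quotient_proj (S n)) quotient_complex_proj_diff.

End QuotientComplex.

Section QuotientChainMap.
Context {C D : cochain_complex R} (S : subcomplex C) (T : subcomplex D).
Variables (phi : cochain_map C D).
Hypothesis phiST : forall n x, S n x -> T n (phi n x).

Lemma quotient_chain_map_diff n (c : quotient_complex S n) :
  quotient_map (@phiST n.+1) (cdiff (quotient_complex S) n c) =
  cdiff (quotient_complex T) n (quotient_map (@phiST n) c).
Proof.
by rewrite -[c]quotient_projK /= !quotient_mapE cochain_map_diff.
Qed.

Definition quotient_chain_map :
    cochain_map (quotient_complex S) (quotient_complex T) :=
  @ChainMap R (quotient_complex S) (quotient_complex T)
    (fun n => quotient_map (@phiST n)) quotient_chain_map_diff.

End QuotientChainMap.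

Section Invariants.
Context {G : Type} {C : cochain_complex R} (a : G -> cochain_map C C) (n : nat).

Lemma invariants_subproof k (u v : cohomology C n) :
  (forall g, cohomology_map (a g) n u = u) ->
  (forall g, cohomology_map (a g) n v = v) ->
  forall g, cohomology_map (a g) n (k *: u + v) = k *: u + v.
Proof. by move=> au av g; rewrite linearP au av. Qed.

Definition invariants : subspace (cohomology C n) :=
  @Subspace R (cohomology C n)
    (fun c => forall g, cohomology_map (a g) n c = c)
    (fun g => linear0 (cohomology_map (a g) n)) invariants_subproof.

Definition invariant_cohomology : lmodType R := subspace_type invariants.

End Invariants.

End Functoriality.

Record action (R : pzRingType) (G : groupType) (V : lmodType R) := Action {
  act :> G -> {linear V -> V};
  act1 : forall v, act 1%g v = v;
  actM : forall g h v, act (g * h)%g v = act g (act h v)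
}.

(* A left R[G]-module V with G-invariant norm. *)
Record isometric_action (R : realType) (G : groupType)
    (V : normedModType R) := IsometricAction {
  isometric_act :> action G V;
  norm_act : forall g v, `|isometric_act g v| = `|v|
}.

Section GroupCochains.
Context {R : pzRingType} {G : groupType}.

Definition tuple_init n (t : n.+1.-tuple G) : n.-tuple G :=
  [tuple tnth t (widen_ord (leqnSn n) k) | k < n].

(* 0-based: [tuple_merge j] multiplies entries j and j.+1 of (g_0, ..., g_n), so
   it is the face carrying the sign (-1)^(j+1) in the differential. *)
Definition tuple_merge n (j : 'I_n) (t : n.+1.-tuple G) : n.-tuple G :=
  [tuple if (k < j)%N then tnth t (widen_ord (leqnSn n) k)
         else if k == j then
           (tnth t (widen_ord (leqnSn n) k) * tnth t (lift ord0 k))%g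
         else tnth t (lift ord0 k) | k < n].

Context {V : lmodType R} (rho : action G V).

Definition group_diff n (f : n.-tuple G -> V) : n.+1.-tuple G -> V :=
  fun t => rho (thead t) (f [tuple of behead t])
    + \sum_(j < n) (-1) ^+ j.+1 *: f (tuple_merge j t)
    + (-1) ^+ n.+1 *: f (tuple_init t).

Lemma group_diff_is_linear n : linear (@group_diff n).
Proof.
move=> a f h; apply/funext => t; rewrite /group_diff.
have E u : (a *: f + h) u = a *: f u + h u by [].
have sZ m (x y : V) : (-1) ^+ m *: (a *: x + y) =
    a *: ((-1) ^+ m *: x) + (-1) ^+ m *: y.
  by rewrite scalerDr !scalerA -signr_odd commr_sign.
under eq_bigr do rewrite E sZ.
rewrite big_split /= -scaler_sumr !E linearP sZ.
rewrite [X in X + _ = _]addrACA [LHS]addrACA -2!scalerDr.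
reflexivity.
Qed.

HB.instance Definition _ n := GRing.isLinear.Build R
  (n.-tuple G -> V) (n.+1.-tuple G -> V) *:%R (@group_diff n)
  (@group_diff_is_linear n).

Definition face n (j : nat) (t : n.+1.-tuple G) : n.-tuple G :=
  [tuple if (k.+1 < j)%N then nth 1%g t k
         else if k.+1 == j then (nth 1%g t k * nth 1%g t k.+1)%g
         else nth 1%g t k.+1 | k < n].

Lemma nth_face n j (t : n.+1.-tuple G) k : (k < n)%N ->
  nth 1%g (face j t) k =
    if (k.+1 < j)%N then nth 1%g t k
    else if k.+1 == j then (nth 1%g t k * nth 1%g t k.+1)%g
    else nth 1%g t k.+1.
Proof. by move=> kn; rewrite -[k]/(val (Ordinal kn)) -tnth_nth tnth_mktuple. Qed.

Definition face_act n (j : nat) (t : n.+1.-tuple G) (v : V) : V :=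
  if j == 0 then rho (nth 1%g t 0) v else v.

Lemma face_face n i j (t : n.+2.-tuple G) : (i < j < n.+3)%N ->
  face i (face j t) = face j.-1 (face i t).
Proof.
move=> /andP[ij jn]; apply/eq_from_tnth => k; rewrite !tnth_mktuple.
have kn := ltn_ord k.
rewrite !nth_face ?ltnS ?(ltnW kn)//; case: j ij jn => //= j ij jn.
case: (ltngtP k.+1 i) => ki; case: (ltngtP k.+1 j) => kj;
  repeat case: ifPn => ?; rewrite ?mulgA//; try lia.
all: try by congr (_ * _)%g; congr nth; lia.
all: try by congr nth; lia.
Qed.

Lemma face_act_face n i j (t : n.+2.-tuple G) v : (i < j < n.+3)%N ->
  face_act j t (face_act i (face j t) v) =
  face_act i t (face_act j.-1 (face i t) v).
Proof.
move=> /andP[ij jn]; rewrite /face_act; case: j ij jn => // j.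
case: i => [|i]; last by case: j.
by move=> _ _; case: j => [|j]; rewrite !nth_face//= actM.
Qed.

Lemma group_diffE n (f : n.-tuple G -> V) t :
  group_diff f t = \sum_(j < n.+2) (-1) ^+ j *: face_act j t (f (face j t)).
Proof.
rewrite big_ord_recl big_ord_recr /= expr0 scale1r addrA; congr (_ + _ + _).
- rewrite /face_act /thead (tnth_nth 1%g); congr (rho _ (f _)).
  apply/eq_from_tnth => k; rewrite tnth_mktuple (tnth_nth 1%g) /= nth_behead.
  by case: k.
- apply: eq_bigr => j _; rewrite /face_act /=; congr (_ *: f _).
  apply/eq_from_tnth => k; rewrite !tnth_mktuple !(tnth_nth 1%g) /=.
  by rewrite /bump /= !add1n ltnS eqSS.
- congr (_ *: f _).
  apply/eq_from_tnth => k; rewrite !tnth_mktuple !(tnth_nth 1%g) /=.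
  by rewrite /bump /= add1n ltnS ltn_ord.
Qed.

Lemma alternating_sum0 (W : lmodType R) n (T : nat -> nat -> W) :
  (forall i j, (i < j < n.+1)%N -> T j i = T i j.-1) ->
  \sum_(j < n.+1) \sum_(i < n) (-1) ^+ (i + j) *: T j i = 0.
Proof.
move=> TT; pose a j i := (-1) ^+ (i + j) *: T j i.
have -> : \sum_(j < n.+1) \sum_(i < n) a j i =
    \sum_(j < n.+1) \sum_(i < n | (i < j)%N) a j i +
    \sum_(j < n.+1) \sum_(i < n | (j <= i)%N) a j i.
  rewrite -big_split; apply: eq_bigr => j _ /=.
  rewrite (bigID (fun i : 'I_n => (i < j)%N)) /=; congr (_ + _).
  by apply: eq_bigl => i; rewrite -leqNgt.
rewrite big_ord_recl big1 ?add0r => [|i]; last by rewrite ltn0.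
rewrite [X in _ + X]big_ord_recr /= [X in _ + (_ + X)]big1 ?addr0; last first.
  by move=> i; rewrite leqNgt ltn_ord.
rewrite (exchange_big_dep xpredT)//= -big_split big1//= => i _.
have -> : \sum_(j < n | (i < bump 0 j)%N) a (bump 0 j) i =
    - \sum_(j < n | (i <= j)%N) a i j.
  rewrite -sumrN; apply: eq_big => j; first by rewrite /bump add1n ltnS.
  rewrite /bump add1n ltnS => ij; rewrite /a TT /=; last by rewrite !ltnS ij/=.
  by rewrite addnS exprS mulN1r scaleNr addnC.
exact: addNr.
Qed.

Lemma group_diffK n (f : n.-tuple G -> V) : group_diff (group_diff f) = 0.
Proof.
apply/funext => t; rewrite group_diffE.
pose T j i := face_act j t (face_act i (face j t) (f (face i (face j t)))).
rewrite -[RHS](@alternating_sum0 V n.+2 T) => [|i j ij]; last first.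
  by rewrite /T face_act_face// face_face.
apply: eq_bigr => j _; rewrite group_diffE /face_act /T /face_act.
case: ifPn => _; rewrite ?linear_sum scaler_sumr; apply: eq_bigr => i _.
  by rewrite linearZ scalerA -exprD addnC.
by rewrite scalerA -exprD addnC.
Qed.

Definition group_complex : cochain_complex R :=
  @Complex R (fun n => (n.-tuple G -> V) : lmodType R)
    (fun n => @group_diff n) group_diffK.

End GroupCochains.

Lemma group_diff1 (R : pzRingType) (G : groupType) (V : lmodType R)
    (rho : action G V) (f : 1.-tuple G -> V) (x y : G) :
  group_diff rho f [tuple x; y] =
  rho x (f [tuple y]) - f [tuple (x * y)%g] + f [tuple x].
Proof.
rewrite /group_diff big_ord1 expr1 sqrrN expr1n scaleN1r scale1r.
congr (_ + _ + _); first by congr (rho _ (f _)); apply/val_inj.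
- by congr (- f _); apply/val_inj; rewrite /= enum_ordSl enum_ord0.
- by congr (f _); apply/val_inj; rewrite /= enum_ordSl enum_ord0.
Qed.

Lemma tuple1E (T : Type) (t : 1.-tuple T) : t = [tuple thead t].
Proof. by case: t => -[|x []]// ?; apply/val_inj. Qed.

Section Pullback.
Context {R : pzRingType} {G H : groupType} {V : lmodType R}.
Variables (phi : {multiplicative H -> G}) (rho : action G V).

Lemma multiplicative1 : phi 1%g = 1%g.
Proof. by apply: (mulgI (phi 1%g)); rewrite -gmulfM !mulg1. Qed.

Lemma pullback_act1 v : rho (phi 1%g) v = v.
Proof. by rewrite multiplicative1 act1. Qed.

Lemma pullback_actM g h v : rho (phi (g * h)%g) v = rho (phi g) (rho (phi h) v).
Proof. by rewrite gmulfM actM. Qed.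

Definition pullback_action : action H V := Action pullback_act1 pullback_actM.

End Pullback.

(* A homomorphism phi : H -> G together with a linear A : V -> W such that
   A (phi(h) v) = h (A v) maps f to (x_1, ..., x_n) |-> A (f (phi x_1, ...)).
   Taking A = id gives the pullback phi^*; conjugation is another instance. *)
Section CompatiblePair.
Context {R : pzRingType} {G H : groupType} {V W : lmodType R}.
Variables (rho : action G V) (sigma : action H W).
Variables (phi : {multiplicative H -> G}) (A : {linear V -> W}).
Hypothesis A_equivariant : forall h v, A (rho (phi h) v) = sigma h (A v).

Definition pair_map n (f : n.-tuple G -> V) : n.-tuple H -> W :=
  fun t => A (f (map_tuple phi t)).

Lemma pair_map_is_linear n : linear (@pair_map n).
Proof. by move=> a f g; apply/funext => t; rewrite /pair_map linearP. Qed.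

HB.instance Definition _ n := GRing.isLinear.Build R
  (n.-tuple G -> V) (n.-tuple H -> W) *:%R (@pair_map n)
  (@pair_map_is_linear n).

Lemma pair_map_diff n (f : n.-tuple G -> V) :
  pair_map (group_diff rho f) = group_diff sigma (pair_map f).
Proof.
apply/funext => t; rewrite /pair_map /group_diff.
rewrite 2!linearD (raddf_sum A) linearZ /=.
congr (_ + _ + _).
- rewrite -A_equivariant; congr (A (rho _ (f _))).
    by rewrite /thead tnth_map.
  by apply/val_inj; rewrite /= behead_map.
- apply: eq_bigr => j _; rewrite linearZ; congr (_ *: A (f _)).
  apply/eq_from_tnth => k; rewrite [RHS]tnth_map !tnth_mktuple !tnth_map.
  by case: ifP => // _; case: ifP => // _; rewrite gmulfM.
- congr (_ *: A (f _)); apply/eq_from_tnth => k.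
  by rewrite [RHS]tnth_map !tnth_mktuple tnth_map.
Qed.

Definition pair_chain_map :
    cochain_map (group_complex rho) (group_complex sigma) :=
  @ChainMap R (group_complex rho) (group_complex sigma)
    (fun n => @pair_map n) pair_map_diff.

End CompatiblePair.

Definition pullback_chain_map (R : pzRingType) (G H : groupType)
    (V : lmodType R) (phi : {multiplicative H -> G}) (rho : action G V) :
    cochain_map (group_complex rho) (group_complex (pullback_action phi rho)) :=
  @pair_chain_map R G H V V rho (pullback_action phi rho) phi idfun
    (fun=> fun=> erefl).

Section BoundedCochains.
Context {R : realType} {G : groupType} {V : normedModType R}.

Lemma bounded_cochainP n (f : n.-tuple G -> V) :
  bounded_fun f <-> exists M, forall t, `|f t| <= M.
Proof.
split=> [|[M fM]].
  by move=> /pinfty_ex_gt0[M _ fM]; exists M => t; exact: fM.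
by exists M; split; rewrite ?num_real// => M' /ltW MM' t _; exact: le_trans MM'.
Qed.

Lemma bounded_cochains0 n : bounded_fun (0 : n.-tuple G -> V).
Proof. by apply/bounded_cochainP; exists 0 => t; rewrite normr0. Qed.

Lemma bounded_cochainsP n a (f h : n.-tuple G -> V) :
  bounded_fun f -> bounded_fun h -> bounded_fun (a *: f + h).
Proof.
move=> /bounded_cochainP[M fM] /bounded_cochainP[M' hM'].
apply/bounded_cochainP; exists (`|a| * M + M') => t.
rewrite (le_trans (ler_normD _ _))// lerD// normrZ.
by rewrite ler_wpM2l.
Qed.

Definition bounded_cochains n : subspace (n.-tuple G -> V) :=
  Subspace (@bounded_cochains0 n) (@bounded_cochainsP n).

Variable rho : isometric_action G V.

Lemma group_diff_bounded n (f : n.-tuple G -> V) :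
  bounded_fun f -> bounded_fun (group_diff rho f).
Proof.
move=> /bounded_cochainP[M fM]; apply/bounded_cochainP.
exists (M + (\sum_(j < n) M) + M) => t.
have sM m s : `|(-1) ^+ m *: f s| <= M by rewrite normrZ normr_sign mul1r.
rewrite (le_trans (ler_normD _ _))// lerD// (le_trans (ler_normD _ _))// lerD//.
  by rewrite norm_act.
by rewrite (le_trans (ler_norm_sum _ _ _))// ler_sum.
Qed.

Definition bounded_subcomplex : subcomplex (group_complex rho) :=
  @Subcomplex R (group_complex rho) bounded_cochains group_diff_bounded.

(* The complex C_{/b} = C / C_b. *)
Definition mod_bounded_complex : cochain_complex R :=
  quotient_complex bounded_subcomplex.

End BoundedCochains.

Section ModBoundedMaps.
Context {R : realType} {G H : groupType} {V W : normedModType R}.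
Variables (rho : isometric_action G V) (sigma : isometric_action H W).
Variables (phi : {multiplicative H -> G}) (A : {linear V -> W}).
Hypothesis A_equivariant : forall h v, A (rho (phi h) v) = sigma h (A v).
Hypothesis A_norm : forall v, `|A v| = `|v|.

Lemma pair_map_bounded n (f : n.-tuple G -> V) :
  bounded_fun f -> bounded_fun (pair_map phi A f).
Proof.
move=> /bounded_cochainP[M fM]; apply/bounded_cochainP.
by exists M => t; rewrite A_norm.
Qed.

Definition mod_bounded_pair_chain_map :
    cochain_map (mod_bounded_complex rho) (mod_bounded_complex sigma) :=
  @quotient_chain_map R _ _ (bounded_subcomplex rho) (bounded_subcomplex sigma)
    (pair_chain_map A_equivariant) pair_map_bounded.

End ModBoundedMaps.

Section PullbackIsometric.
Context {R : realType} {G H : groupType} {V : normedModType R}.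
Variables (phi : {multiplicative H -> G}) (rho : isometric_action G V).

Definition pullback_isometric : isometric_action H V :=
  @IsometricAction R H V (pullback_action phi rho)
    (fun h v => norm_act rho (phi h) v).

Definition mod_bounded_pullback_chain_map :
    cochain_map (mod_bounded_complex rho)
              (mod_bounded_complex pullback_isometric) :=
  @mod_bounded_pair_chain_map R G H V V rho pullback_isometric phi idfun
    (fun=> fun=> erefl) (fun=> erefl).

End PullbackIsometric.

Section Cohomology.
Context {R : realType} {G : groupType} {V : normedModType R}.
Variables (rho : isometric_action G V) (n : nat).

Definition group_cohomology : lmodType R := cohomology (group_complex rho) n.

Definition mod_bounded_cohomology : lmodType R :=
  cohomology (mod_bounded_complex rho) n.

Definition to_mod_bounded :
    {linear group_cohomology -> mod_bounded_cohomology} :=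
  cohomology_map (quotient_complex_proj (bounded_subcomplex rho)) n.

End Cohomology.

(* The inflation is p^*; below, the restriction is i^* with values in the
   invariants. *)
Section Inflation.
Context {R : realType} {G Gamma : groupType} {V : normedModType R}.
Variables (p : {multiplicative G -> Gamma}) (rho : isometric_action Gamma V).

Definition inflation n :
    {linear group_cohomology rho n ->
            group_cohomology (pullback_isometric p rho) n} :=
  cohomology_map (pullback_chain_map p rho) n.

Definition mod_bounded_inflation n :
    {linear mod_bounded_cohomology rho n ->
            mod_bounded_cohomology (pullback_isometric p rho) n} :=
  cohomology_map (mod_bounded_pullback_chain_map p rho) n.

End Inflation.

Definition short_exact (N G Gamma : groupType) (i : {multiplicative N -> G})
    (p : {multiplicative G -> Gamma}) : Prop :=
  [/\ injective i,
      forall g, p g = 1%g <-> exists x, i x = g &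
      forall c, exists g, p g = c].

Section Extension.
Context {N G Gamma : groupType}.
Context {i : {multiplicative N -> G}} {p : {multiplicative G -> Gamma}}.
Hypothesis e : short_exact i p.

Lemma proj_kernel x : p (i x) = 1%g.
Proof. by case: e => _ /(_ (i x))[_ pi] _; apply: pi; exists x. Qed.

Lemma conj_in_kernel g x : exists y, i y = (i x ^ g)%g.
Proof.
case: e => _ /(_ (i x ^ g)%g)[+ _] _; apply.
by rewrite conjgE !gmulfM proj_kernel mul1g -gmulfM mulVg multiplicative1.
Qed.

(* The unique y in N with i(y) = g^-1 i(x) g; in the library, x ^ g is
   g^-1 x g. *)
Definition conj_kernel g x : N := projT1 (cid (conj_in_kernel g x)).

Lemma conj_kernelE g x : i (conj_kernel g x) = (i x ^ g)%g.
Proof. by rewrite /conj_kernel; case: cid. Qed.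

Lemma conj_kernelM g : {morph conj_kernel g : x y / (x * y)%g}.
Proof.
move=> x y; case: e => i_inj _ _; apply: i_inj.
by rewrite conj_kernelE !gmulfM !conj_kernelE conjMg.
Qed.

HB.instance Definition _ g :=
  isMultiplicative.Build N N (conj_kernel g) (conj_kernelM g).

Context {R : realType} {V : normedModType R}.
Variable rho : isometric_action Gamma V.

Local Notation rhoG := (pullback_isometric p rho).
Local Notation rhoN := (pullback_isometric i rhoG).

Lemma kernel_act_trivial x v : rhoN x v = v.
Proof. by rewrite /= proj_kernel act1. Qed.

Lemma conj_equivariant g x v :
  rhoG g (rhoN (conj_kernel g x) v) = rhoN x (rhoG g v).
Proof. by rewrite !kernel_act_trivial. Qed.

(* ({}^g f)(x_1, ..., x_n) = g . f(g^-1 x_1 g, ..., g^-1 x_n g). *)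
Definition conj_chain_map g :
    cochain_map (group_complex rhoN) (group_complex rhoN) :=
  @pair_chain_map R N N V V rhoN rhoN (conj_kernel g) (rhoG g)
    (conj_equivariant g).

Definition mod_bounded_conj_chain_map g :
    cochain_map (mod_bounded_complex rhoN) (mod_bounded_complex rhoN) :=
  @mod_bounded_pair_chain_map R N N V V rhoN rhoN (conj_kernel g) (rhoG g)
    (conj_equivariant g) (norm_act rhoG g).

Definition invariant_group_cohomology n : lmodType R :=
  invariant_cohomology conj_chain_map n.

Definition invariant_mod_bounded_cohomology n : lmodType R :=
  invariant_cohomology mod_bounded_conj_chain_map n.

Lemma conj_pullback g (f : 1.-tuple G -> V) (t : 1.-tuple N) :
  pair_map (conj_kernel g) (rhoG g) (pair_map i idfun f) t
    - pair_map i idfun f t =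
  group_diff rhoG f [tuple g; (i (thead t) ^ g)%g]
    - group_diff rhoG f [tuple i (thead t); g].
Proof.
have -> : pair_map (conj_kernel g) (rhoG g) (pair_map i idfun f) t =
    rhoG g (f [tuple (i (thead t) ^ g)%g]).
  rewrite /pair_map; congr (rhoG g (f _)); apply/eq_from_tnth => k.
  by rewrite !tnth_map conj_kernelE ord1.
have -> : pair_map i idfun f t = f [tuple i (thead t)].
  by congr f; apply/eq_from_tnth => k; rewrite tnth_map ord1.
rewrite !group_diff1 -conjgC [rhoG (i _) _]/= proj_kernel act1.
by rewrite opprD opprB addrACA !addrA !subrK.
Qed.

Lemma restriction_invariant (c : group_cohomology rhoG 1) :
  invariants conj_chain_map 1
    (cohomology_map (pullback_chain_map i rhoG) 1 c).
Proof.
have [z ->] := cohomology_classK c.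
rewrite cohomology_mapE => g; rewrite cohomology_mapE.
congr cohomology_class; apply/val_inj/funext => t.
apply/eqP; rewrite -subr_eq0; apply/eqP; rewrite [LHS]conj_pullback.
have z0 : group_diff rhoG (val z) = 0 := subspace_val z.
by rewrite z0 subrr.
Qed.

Definition restriction :
    {linear group_cohomology rhoG 1 -> invariant_group_cohomology 1} :=
  subspace_corestrict restriction_invariant.

Lemma mod_bounded_restriction_invariant (c : mod_bounded_cohomology rhoG 1) :
  invariants mod_bounded_conj_chain_map 1
    (cohomology_map (mod_bounded_pullback_chain_map i rhoG) 1 c).
Proof.
have [z ->] := cohomology_classK c.
rewrite cohomology_mapE => g; rewrite cohomology_mapE.
congr cohomology_class; apply/val_inj.
have [M dM] : exists M, forall t, `|group_diff rhoG (repr (val z)) t| <= M.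
  apply/bounded_cochainP; rewrite -[group_diff _ _]subr0.
  suff /quotient_projP : quotient_proj (bounded_cochains 2)
    (group_diff rhoG (repr (val z))) =
    quotient_proj (bounded_cochains 2) 0 by [].
  rewrite linear0 -[RHS](subspace_val z).
  by rewrite -[in RHS](quotient_projK (val z)) /= quotient_mapE.
rewrite /= [X in quotient_map _ X]/quotient_map quotient_mapE.
rewrite [RHS]/quotient_map.
apply/quotient_projP/bounded_cochainP; exists (M + M) => t.
rewrite [X in `|X|]conj_pullback (le_trans (ler_normB _ _))//.
by rewrite lerD.
Qed.

Definition mod_bounded_restriction :
    {linear mod_bounded_cohomology rhoG 1 ->
            invariant_mod_bounded_cohomology 1} :=
  subspace_corestrict mod_bounded_restriction_invariant.

Lemma to_mod_bounded_invariant n (c : group_cohomology rhoN n) :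
  invariants conj_chain_map n c ->
  invariants mod_bounded_conj_chain_map n (to_mod_bounded rhoN n c).
Proof.
move=> cinv g; rewrite -[in RHS](cinv g).
have [z ->] := cohomology_classK c.
rewrite /to_mod_bounded !cohomology_mapE; congr cohomology_class.
by apply/val_inj; rewrite /= quotient_mapE.
Qed.

Definition invariant_to_mod_bounded n :
    {linear invariant_group_cohomology n ->
            invariant_mod_bounded_cohomology n} :=
  subspace_map (@to_mod_bounded_invariant n).

(* F restricts to a cocycle on N representing c, and delta F = p^* alpha. *)
Definition transgression_data (c : invariant_group_cohomology 1)
    (F : 1.-tuple G -> V) (alpha : cocycle (group_complex rho) 2) : Prop :=
  (exists f : cocycle (group_complex rhoN) 1,
     val c = cohomology_class f /\ pullback_chain_map i rhoG 1 F = val f) /\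
  group_diff rhoG F = pullback_chain_map p rho 2 (val alpha).

(* Every class admits such data, and tau is computed by any choice of it; this
   determines tau. *)
Definition is_transgression
    (tau : invariant_group_cohomology 1 -> group_cohomology rho 2) : Prop :=
  forall c, (exists F alpha, transgression_data c F alpha) /\
    (forall F alpha, transgression_data c F alpha ->
       tau c = cohomology_class alpha).

End Extension.

Arguments transgression_data {N G Gamma i p} e {R V} rho c F alpha.
Arguments is_transgression {N G Gamma i p} e {R V} rho tau.

Definition exact_at (R : pzRingType) (A B C : lmodType R)
    (f : {linear A -> B}) (g : {linear B -> C}) : Prop :=
  forall y, g y = 0 <-> exists x, f x = y.

Definition five_term_exact (R : pzRingType) (A B C D E : lmodType R)
    (f1 : {linear A -> B}) (f2 : {linear B -> C})
    (f3 : {linear C -> D}) (f4 : {linear D -> E}) : Prop :=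
  [/\ injective f1, exact_at f1 f2, exact_at f2 f3 & exact_at f3 f4].

(* Main.v *)
(* Both sequences are instances of one statement about cochains modulo "small"
   ones, where small means zero or bounded. Fix a normalized section s of p and
   write F ~ F' if F - F' is small. The five-term diagram chase then reduces to
   cochain computations: a 1-cochain F on G that is small on N and has
   dF ~ p^* alpha satisfies F(xg) ~ F(g), so it descends to Gamma; and a
   1-cocycle f mod small on N that is exactly G-invariant extends by
   F(x s(c)) = f(x), for which dF(g, h) depends on (p g, p h) only, up to a
   small error.

   A G-invariant class mod bounded gives only |g.f(g^-1 x g) - f(x)| <= C_g with
   C_g depending on g. Homogenization x |-> lim f(x^(2^n)) / 2^n, which needs V
   to be complete, replaces f by an exactly invariant representative. *)

Require Import Defs.
From HB Require Import structures.
From mathcomp Require Import all_boot all_order all_algebra.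
From mathcomp Require Import boolp classical_sets functions reals topology.
From mathcomp Require Import normedtype sequences.

Set Implicit Arguments.
Unset Strict Implicit.
Unset Printing Implicit Defensive.

Import Order.TTheory GRing.Theory Num.Theory numFieldNormedType.Exports.
Local Open Scope classical_set_scope.
Local Open Scope ring_scope.

(** * The five-term diagram chase *)

(** Two values over the same [a] differ by a value over 0, so the relation is the graph of a
    function. This yields a linear [tau] although the cochains that compute it are chosen without
    any coherence. *)
Lemma linear_of_relation (R : pzRingType) (A B : lmodType R)
    (T : A -> B -> Prop) :
  (forall a, exists b, T a b) ->
  (forall k a a' b b', T a b -> T a' b' -> T (k *: a + a') (k *: b + b')) ->
  (forall b, T 0 b -> b = 0) ->
  exists f : {linear A -> B}, forall a b, T a b -> f a = b.
Proof.
move=> /choice[f Tf] Tlin T0.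
have funT a b : T a b -> f a = b.
  move=> Tab; apply/eqP; rewrite eq_sym -subr_eq0 -scaleN1r addrC; apply/eqP/T0.
  by rewrite -[0](addNr a) -scaleN1r; exact: Tlin.
have f_lin : linear f by move=> k a a'; apply: funT; exact: Tlin.
pose f_mixin := GRing.isLinear.Build R A B *:%R f f_lin.
pose F : {linear A -> B} := HB.pack f f_mixin.
by exists F.
Qed.

Section CohomologyClasses.
Context {R : pzRingType}.
Implicit Types C D : cochain_complex R.

Lemma cohomology_class_is_linear C n : linear (@cohomology_class R C n).
Proof. by move=> k z z'; rewrite /cohomology_class linearP. Qed.

HB.instance Definition _ C n :=
  GRing.isLinear.Build R (cocycle C n) (cohomology C n) *:%R
    (@cohomology_class R C n) (@cohomology_class_is_linear C n).

Lemma cohomology_class_eq0 C n (z : cocycle C n.+1) :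
  cohomology_class z = 0 <-> exists u, cdiff C n u = val z.
Proof.
rewrite -(linear0 (@cohomology_class R C n.+1)).
by split=> [/quotient_projP | h]; last apply/quotient_projP; rewrite subr0.
Qed.

(** Used for the three ladder squares that do not involve the connecting map, since they commute
    already on cochains. *)
Lemma cohomology_map_square C C' D D' (f : cochain_map C D)
    (g : cochain_map D D') (f' : cochain_map C C') (g' : cochain_map C' D') n :
  (forall x, g n (f n x) = g' n (f' n x)) ->
  forall c, cohomology_map g n (cohomology_map f n c) =
            cohomology_map g' n (cohomology_map f' n c).
Proof.
move=> fg c; have [z ->] := cohomology_classK c; rewrite !cohomology_mapE.
by congr cohomology_class; apply/val_inj/fg.
Qed.

End CohomologyClasses.

(** * Exactness deduced from cochain-level properties of three complexes *)

Section AbstractFiveTerm.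
Context {R : pzRingType} {CN CG CQ : cochain_complex R} {I : Type}.
Variables (infl : cochain_map CQ CG) (restr : cochain_map CG CN).
Variable conj : I -> cochain_map CN CN.
Variable res : {linear cohomology CG 1 -> invariant_cohomology conj 1}.
Hypothesis val_res : forall c, val (res c) = cohomology_map restr 1 c.

(** For the ordinary group complexes this unfolds to [transgression_data]; stated for arbitrary
    complexes, it also describes the connecting map modulo bounded cochains. *)
Definition connecting_data (c : invariant_cohomology conj 1) (F : CG 1%N)
    (alpha : cocycle CQ 2) : Prop :=
  (exists f : cocycle CN 1, val c = cohomology_class f /\ restr 1 F = val f) /\
  cdiff CG 1 F = infl 2 (val alpha).

Definition is_connecting
    (tau : invariant_cohomology conj 1 -> cohomology CQ 2) : Prop :=
  forall c, (exists F alpha, connecting_data c F alpha) /\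
    (forall F alpha, connecting_data c F alpha ->
       tau c = cohomology_class alpha).

Hypothesis infl_inj : forall n, injective (infl n).
Hypothesis infl0_surj : forall v, exists u, infl 0 u = v.
Hypothesis diff_kernel0 : forall v, cdiff CN 0 v = 0.
Hypothesis descent : forall F alpha, restr 1 F = 0 -> cdiff CQ 2 alpha = 0 ->
  cdiff CG 1 F = infl 2 alpha -> exists b, infl 1 b = F.
Hypothesis constant_cocycle : forall b,
  cdiff CN 1 (restr 1 (infl 1 b)) = 0 -> restr 1 (infl 1 b) = 0.
Hypothesis extension : forall f, cdiff CN 1 f = 0 ->
  (forall g, conj g 1 f = f) ->
  exists F alpha, restr 1 F = f /\ cdiff CG 1 F = infl 2 alpha.
Hypothesis normalization : forall alpha, exists b,
  restr 2 (infl 2 (alpha - cdiff CQ 1 b)) = 0.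
Hypothesis restr_conj : forall F alpha g, cdiff CQ 2 alpha = 0 ->
  restr 2 (infl 2 alpha) = 0 -> cdiff CG 1 F = infl 2 alpha ->
  conj g 1 (restr 1 F) = restr 1 F.

(** There are no nonzero 1-coboundaries on N, because N acts trivially. A class in degree 1 is thus
    a single cocycle, and an invariant class is an invariant cocycle. *)
Lemma kernel_class_inj : injective (@cohomology_class R CN 1).
Proof.
move=> z z' zz'; apply/val_inj/eqP; rewrite -subr_eq0; apply/eqP.
have /cohomology_class_eq0[u] : cohomology_class (z - z') = 0.
  by rewrite linearB /= zz' subrr.
by rewrite diff_kernel0 raddfB.
Qed.

Lemma connecting_data_exists c : exists F alpha, connecting_data c F alpha.
Proof.
have [f cf] := cohomology_classK (val c).
have [|F [alpha [Ff dF]]] := extension (subspace_val f).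
  move=> g; have := subspace_val c g; rewrite cf cohomology_mapE.
  by move=> /kernel_class_inj/(congr1 val).
(* The inflation of [cdiff CQ 2 alpha] is the differential of [cdiff CG 1 F], hence 0, and inflation
   is injective on cochains. *)
have dalpha : cdiff CQ 2 alpha = 0.
  by apply: infl_inj; rewrite cochain_map_diff -dF cdiffK linear0.
exists F, (to_subspace (dalpha : cocycles CQ 2 alpha)).
by split; first exists f.
Qed.

Lemma connecting_data_linear k c c' F F' alpha alpha' :
  connecting_data c F alpha -> connecting_data c' F' alpha' ->
  connecting_data (k *: c + c') (k *: F + F') (k *: alpha + alpha').
Proof.
move=> [[f [cf Ff]] dF] [[f' [cf' Ff']] dF']; split.
  exists (k *: f + f'); split; first by rewrite !linearP /= cf cf'.
  by rewrite !linearP /= Ff Ff'.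
by rewrite linearP dF dF' -linearP.
Qed.

(** This makes [tau] well defined: over the zero class [F] vanishes on N, so it descends to some
    [b], and [alpha] is the coboundary of [b]. *)
Lemma connecting_data0 F alpha :
  connecting_data 0 F alpha -> cohomology_class alpha = 0.
Proof.
move=> [[f [f0 Ff]] dF].
have {}f0 : f = 0 by apply: kernel_class_inj; rewrite -f0 !linear0.
have [|b bF] := descent _ (subspace_val alpha) dF.
  by rewrite Ff f0 linear0.
apply/cohomology_class_eq0; exists b; apply: infl_inj.
by rewrite cochain_map_diff bF.
Qed.

(** In degree 0 every cochain of G is inflated, so a primitive of an inflated cocycle comes from a
    primitive on the quotient. *)
Lemma infl_exact0 : injective (cohomology_map infl 1).
Proof.
apply: raddf_inj => c; have [z ->] := cohomology_classK c.
rewrite /= cohomology_mapE => /cohomology_class_eq0[v].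
have [u <-] := infl0_surj v.
rewrite -cochain_map_diff => /infl_inj uz.
by apply/cohomology_class_eq0; exists u.
Qed.

Lemma infl_res_exact : exact_at (cohomology_map infl 1) res.
Proof.
move=> c; have [z ->] := cohomology_classK c; split.
  move=> /(congr1 val); rewrite val_res cohomology_mapE.
  rewrite -[RHS](linear0 (@cohomology_class R CN 1)) => /kernel_class_inj.
  move=> /(congr1 val) iz.
  (* The restriction of [z] is zero as a cochain, not only as a class, so [z] itself descends. *)
  have [|||b bz] := descent (F := val z) (alpha := 0).
  - exact: iz.
  - by rewrite linear0.
  - by rewrite linear0; exact: subspace_val z.
  have db : cdiff CQ 1 b = 0.
    apply: infl_inj; rewrite cochain_map_diff bz linear0.
    exact: subspace_val z.
  exists (cohomology_class (to_subspace (db : cocycles CQ 1 b))).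
  by rewrite cohomology_mapE; congr cohomology_class; apply/val_inj.
move=> [c']; have [b ->] := cohomology_classK c' => <-.
apply/val_inj; rewrite val_res !cohomology_mapE.
rewrite -[RHS](linear0 (@cohomology_class R CN 1)).
congr cohomology_class; apply/val_inj/constant_cocycle.
rewrite -!cochain_map_diff (_ : cdiff CQ 1 (val b) = 0) ?linear0//.
exact: subspace_val b.
Qed.

Lemma abstract_five_term :
  exists tau : {linear invariant_cohomology conj 1 -> cohomology CQ 2},
    is_connecting tau /\
    five_term_exact (cohomology_map infl 1) res tau (cohomology_map infl 2).
Proof.
have [|||tau tauE] := @linear_of_relation R (invariant_cohomology conj 1)
    (cohomology CQ 2) (fun c d => exists F alpha,
      connecting_data c F alpha /\ d = cohomology_class alpha).
- move=> c; have [F [alpha cFa]] := connecting_data_exists c.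
  by exists (cohomology_class alpha), F, alpha.
- move=> k c c' d d' [F [alpha [cFa ->]]] [F' [alpha' [cFa' ->]]].
  exists (k *: F + F'), (k *: alpha + alpha').
  by rewrite linearP; split=> //; exact: connecting_data_linear.
- by move=> d [F [alpha [/connecting_data0 + ->]]].
have {}tauE c F alpha :
    connecting_data c F alpha -> tau c = cohomology_class alpha.
  by move=> cFa; apply: tauE; exists F, alpha.
exists tau; split.
  by move=> c; split; [exact: connecting_data_exists | exact: tauE].
split.
- exact: infl_exact0.
- exact: infl_res_exact.
- move=> c; split.
    have [F [alpha cFa]] := connecting_data_exists c.
    rewrite (tauE _ _ _ cFa) => /cohomology_class_eq0[b db].
    case: cFa => -[f [cf Ff]] dF.
    (* The correction of [F] by the inflation of [b] makes it a cocycle; it must not change the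
       restriction to N. *)
    have iF0 : restr 1 (infl 1 b) = 0.
      apply: constant_cocycle; rewrite -!cochain_map_diff db -dF.
      by rewrite cochain_map_diff Ff; exact: subspace_val f.
    have dF' : cdiff CG 1 (F - infl 1 b) = 0.
      by rewrite linearB dF -cochain_map_diff db subrr.
    exists (cohomology_class (to_subspace (dF' : cocycles CG 1 _))).
    apply/val_inj; rewrite val_res cohomology_mapE cf.
    by congr cohomology_class; apply/val_inj; rewrite /= linearB iF0 subr0.
  move=> [c']; have [z ->] := cohomology_classK c' => <-.
  (* A restricted cocycle extends to G by itself, with zero differential. *)
  rewrite (tauE _ (val z) 0) ?linear0//; split.
    exists (cocycle_map restr 1 z).
    by rewrite val_res cohomology_mapE.
  by rewrite !linear0; exact: subspace_val z.
- move=> d; split.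
    have [alpha ->] := cohomology_classK d; rewrite cohomology_mapE.
    move=> /cohomology_class_eq0[F dF].
    (* The coboundary of [b] changes [alpha] within its class so that its inflation vanishes on N.
       Then [F] minus the inflation of [b] restricts to an invariant cocycle, which is the required
       preimage. *)
    have [b] := normalization (val alpha).
    set alpha' := _ - _ => norm_alpha'.
    have dalpha' : cdiff CQ 2 alpha' = 0.
      rewrite linearB cdiffK subr0; exact: subspace_val alpha.
    have dF' : cdiff CG 1 (F - infl 1 b) = infl 2 alpha'.
      by rewrite !linearB dF cochain_map_diff.
    have df : cdiff CN 1 (restr 1 (F - infl 1 b)) = 0.
      by rewrite -cochain_map_diff dF'.
    pose f : cocycle CN 1 := to_subspace (df : cocycles CN 1 _).
    have f_inv : invariants conj 1 (cohomology_class f).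
      move=> g; rewrite cohomology_mapE; congr cohomology_class; apply/val_inj.
      exact: restr_conj dalpha' norm_alpha' dF'.
    exists (to_subspace f_inv).
    rewrite (tauE _ (F - infl 1 b)
      (to_subspace (dalpha' : cocycles CQ 2 alpha'))); last first.
      by split=> //; exists f.
    apply/eqP; rewrite -subr_eq0 -linearB; apply/eqP/cohomology_class_eq0.
    by exists (- b); rewrite linearN raddfB /= /alpha' addrAC subrr sub0r.
  move=> [c <-]; have [F [alpha cFa]] := connecting_data_exists c.
  rewrite (tauE _ _ _ cFa) cohomology_mapE; apply/cohomology_class_eq0.
  by exists F; case: cFa.
Qed.

End AbstractFiveTerm.

(** * Small cochains *)

Lemma map_tuple1 (T U : Type) (h : T -> U) x :
  map_tuple h [tuple x] = [tuple h x].
Proof. exact/val_inj. Qed.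

Lemma map_tuple2 (T U : Type) (h : T -> U) x y :
  map_tuple h [tuple x; y] = [tuple h x; h y].
Proof. exact/val_inj. Qed.

Lemma tuple2E (T : Type) (t : 2.-tuple T) :
  exists x y, t = [tuple x; y].
Proof. by case: t => -[|x [|y []]]// ?; exists x, y; apply/val_inj. Qed.

Section LowDegrees.
Context {R : pzRingType} {G : groupType} {V : lmodType R} (rho : action G V).

Lemma group_diff0 (f : 0.-tuple G -> V) x :
  group_diff rho f [tuple x] = rho x (f [tuple]) - f [tuple].
Proof.
rewrite /group_diff big_ord0 addr0 expr1 scaleN1r.
by congr (rho _ (f _) - f _); rewrite [LHS]tuple0.
Qed.

Lemma group_diff2 (f : 2.-tuple G -> V) x y z :
  group_diff rho f [tuple x; y; z] =
  rho x (f [tuple y; z]) - f [tuple (x * y)%g; z] + f [tuple x; (y * z)%g]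
    - f [tuple x; y].
Proof.
rewrite /group_diff big_ord_recl big_ord1 expr1 sqrrN expr1n scaleN1r.
rewrite scale1r exprS sqrrN expr1n mulr1 scaleN1r addrA.
congr (rho _ (f _) - f _ + f _ - f _); apply/val_inj => //=;
  by rewrite !enum_ordSl enum_ord0.
Qed.

End LowDegrees.

Section Small.
Context {R : realType} {V : normedModType R}.
Variable K : set R.

(* For K = {0} this is f = 0, and for K = R it is boundedness. *)
Definition small (T : Type) (f : T -> V) : Prop :=
  exists2 M, K M & forall t, `|f t| <= M.

Hypotheses (K0 : K 0) (KD : forall a b, K a -> K b -> K (a + b)).
Context {T : Type}.
Implicit Types f h : T -> V.

Lemma eq_small f h : f =1 h -> small f -> small h.
Proof. by move=> /funext->. Qed.

Lemma small0 : small (fun _ : T => 0).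
Proof. by exists 0 => // t; rewrite normr0. Qed.

Lemma smallD f h : small f -> small h -> small (fun t => f t + h t).
Proof.
move=> [a Ka fa] [b Kb hb]; exists (a + b) => [|t]; first exact: KD.
by rewrite (le_trans (ler_normD _ _))// lerD.
Qed.

Lemma smallN f : small f -> small (fun t => - f t).
Proof. by move=> [a Ka fa]; exists a => // t; rewrite normrN. Qed.

Lemma smallB f h : small f -> small h -> small (fun t => f t - h t).
Proof. by move=> fs hs; apply: smallD => //; exact: smallN. Qed.

Lemma small_comp (T' : Type) f (phi : T' -> T) :
  small f -> small (fun t => f (phi t)).
Proof. by move=> [a Ka fa]; exists a. Qed.

Lemma small_isometry (A : T -> V -> V) f : (forall t v, `|A t v| = `|v|) ->
  small f -> small (fun t => A t (f t)).
Proof. by move=> An [a Ka fa]; exists a => // t; rewrite An. Qed.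

Lemma small_onto (T' : Type) (phi : T' -> T) f :
  (forall t, exists t', phi t' = t) -> small (fun t => f (phi t)) -> small f.
Proof. by move=> onto [a Ka fa]; exists a => // t; have [t' <-] := onto t. Qed.

End Small.

(** * Normalized sections and the decomposition of G along N *)

Section NormalizedSection.
Context {N G Gamma : groupType}.
Context {i : {multiplicative N -> G}} {p : {multiplicative G -> Gamma}}.
Hypothesis e : short_exact i p.

Lemma normalized_section : exists (s : Gamma -> G) (r : G -> N),
  [/\ s 1%g = 1%g, cancel s p & forall g, (i (r g) * s (p g))%g = g].
Proof.
have [_ ker /choice[s0 s0K]] := e.
(* Right division by the lift of 1, which lies in the kernel of [p], normalizes the section without
   changing its projection. *)
pose s c := (s0 c * (s0 1)^-1)%g.
have sK : cancel s p.
  move=> c; apply: (mulIg (p (s0 1%g))); rewrite -gmulfM mulgVK.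
  by rewrite !s0K mulg1.
have /choice[r rE] : forall g, exists x, i x = (g * (s (p g))^-1)%g.
  move=> g; apply/ker; apply: (mulIg (p (s (p g)))).
  by rewrite -gmulfM mulgVK sK mul1g.
exists s, r; split=> // [|g]; first by rewrite /s mulgV.
by rewrite rE mulgVK.
Qed.

End NormalizedSection.

(** * Cochain computations on the extension, up to small errors *)

Section SmallExtension.
Context {N G Gamma : groupType}.
Context {i : {multiplicative N -> G}} {p : {multiplicative G -> Gamma}}.
Hypothesis e : short_exact i p.
Context {R : realType} {V : normedModType R}.
Variable rho : isometric_action Gamma V.
Variable K : set R.
Hypotheses (K0 : K 0) (KD : forall a b, K a -> K b -> K (a + b)).

Local Notation rhoG := (pullback_isometric p rho).
Local Notation rhoN := (pullback_isometric i rhoG).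
Local Notation pull q := (@pair_map R _ _ V V q idfun _).

Lemma pair_map1 (H H' : groupType) (q : {multiplicative H' -> H})
    (f : 1.-tuple H -> V) x : pull q f [tuple x] = f [tuple q x].
Proof. by rewrite /pair_map map_tuple1. Qed.

Lemma pair_map2 (H H' : groupType) (q : {multiplicative H' -> H})
    (f : 2.-tuple H -> V) x y : pull q f [tuple x; y] = f [tuple q x; q y].
Proof. by rewrite /pair_map map_tuple2. Qed.

(** Each tuple in Gamma lifts entrywise through the section, so the same bound serves for [f]. *)
Lemma small_pullback_inj n (f : n.-tuple Gamma -> V) :
  small K (pull p f) -> small K f.
Proof.
have [s [r [_ sK _]]] := normalized_section e.
apply: (small_onto (phi := map_tuple p)) => t; exists (map_tuple s t).
by apply/val_inj; rewrite /= -map_comp map_id_in// => x _; exact: sK.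
Qed.

(** The differential of [alpha] is alpha(1,c) - alpha(1,1) at (1,1,c), and c.alpha(1,1) - alpha(c,1)
    at (c,1,1). *)
Lemma small_normalize (alpha : 2.-tuple Gamma -> V) :
  small K (group_diff rho alpha) ->
  small K (fun _ : unit => alpha [tuple 1%g; 1%g]) ->
  small K (fun c => alpha [tuple 1%g; c]) /\
  small K (fun c => alpha [tuple c; 1%g]).
Proof.
move=> dalpha alpha1; split.
  apply: eq_small (smallD KD
    (small_comp (fun c : Gamma => [tuple 1%g; 1%g; c]) dalpha)
    (small_comp (fun c : Gamma => tt) alpha1)) => c.
  by rewrite group_diff2 act1 !mul1g !subrK.
apply: eq_small (smallB KD
  (small_isometry (A := fun c => rho c) (norm_act rho)
     (small_comp (fun c : Gamma => tt) alpha1))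
  (small_comp (fun c : Gamma => [tuple c; 1%g; 1%g]) dalpha)) => c.
by rewrite group_diff2 !mulg1 subrK opprB addrC subrK.
Qed.

Lemma small_descent (F : 1.-tuple G -> V) (alpha : 2.-tuple Gamma -> V) :
  small K (pull i F) -> small K (group_diff rho alpha) ->
  small K (group_diff rhoG F - pull p alpha) ->
  exists b : 1.-tuple Gamma -> V, small K (pull p b - F).
Proof.
move=> F_N dalpha dF; have [s [r [_ sK rE]]] := normalized_section e.
(* The differential of [F] at (1,1) is F(1), which is small because 1 comes from N. *)
have alpha1 : small K (fun _ : unit => alpha [tuple 1%g; 1%g]).
  apply: eq_small (smallB KD
    (small_comp (fun _ : unit => [tuple 1%g]) F_N)
    (small_comp (fun _ : unit => [tuple 1%g; 1%g]) dF)) => _.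
  rewrite pair_map1 -[X in _ - X]/(_ - _) group_diff1 pair_map2.
  by rewrite !multiplicative1 act1 mulg1 subrr add0r opprB addrC subrK.
have [alphal _] := small_normalize dalpha alpha1.
exists (fun t => F [tuple s (thead t)]).
(* Write g = x s(c) with x in N and c = p(g). Then dF(x, s(c)) = F(s(c)) - F(g) + F(x), and it is
   compared with alpha(1,c). *)
apply: eq_small (smallB KD (smallD KD
  (small_comp (fun t : 1.-tuple G => [tuple i (r (thead t)); s (p (thead t))])
     dF)
  (small_comp (fun t : 1.-tuple G => p (thead t)) alphal))
  (small_comp (fun t : 1.-tuple G => [tuple r (thead t)]) F_N)) => t.
rewrite -[X in X + _ - _]/(_ - _) group_diff1 pair_map1 pair_map2 rE sK.
rewrite [rhoG (i _) _]/= (proj_kernel e) act1 subrK addrK.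
by rewrite -[RHS]/(_ - _) [in RHS](tuple1E t) pair_map1.
Qed.

(* i^* p^* b is constant, and N acts trivially, so that d fixes it. *)
Lemma small_constant (b : 1.-tuple Gamma -> V) :
  small K (group_diff rhoN (pull i (pull p b))) -> small K (pull i (pull p b)).
Proof.
move=> db; apply: eq_small
  (small_comp (fun t : 1.-tuple N => [tuple thead t; thead t]) db) => t.
rewrite group_diff1 [in RHS](tuple1E t) !pair_map1 !proj_kernel//.
by rewrite kernel_act_trivial// subrr add0r.
Qed.

Lemma small_normalization (alpha : 2.-tuple Gamma -> V) :
  exists b : 1.-tuple Gamma -> V,
    small K (pull i (pull p (alpha - group_diff rho b))).
Proof.
(* The differential of a constant 1-cochain takes that constant as its value at (1,1), so the
   difference vanishes exactly on N. *)
exists (fun=> alpha [tuple 1%g; 1%g]); apply: eq_small (small0 K0) => t.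
have [x [y ->]] := tuple2E t; rewrite !pair_map2 !proj_kernel//.
by rewrite -[RHS]/(_ - _) group_diff1 act1 subrK subrr.
Qed.

(** By [conj_pullback] the defect of invariance at x is dF(g, g^-1 x g) - dF(x, g). Up to small
    errors this is alpha(p g, 1) - alpha(1, p g), and both terms are small by [small_normalize]. *)
Lemma small_restr_conj (F : 1.-tuple G -> V) (alpha : 2.-tuple Gamma -> V) g :
  small K (group_diff rho alpha) -> small K (pull i (pull p alpha)) ->
  small K (group_diff rhoG F - pull p alpha) ->
  small K (pair_map (conj_kernel e g) (rhoG g) (pull i F) - pull i F).
Proof.
move=> dalpha alpha_N dF.
have alpha1 : small K (fun _ : unit => alpha [tuple 1%g; 1%g]).
  apply: eq_small (small_comp (fun _ : unit => [tuple 1%g; 1%g]) alpha_N) => _.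
  by rewrite !pair_map2 !multiplicative1.
have [alphal alphar] := small_normalize dalpha alpha1.
apply: eq_small (smallB KD
  (smallD KD (small_comp (fun t : 1.-tuple N => [tuple g; (i (thead t) ^ g)%g])
     dF) (small_comp (fun _ : 1.-tuple N => p g) alphar))
  (smallD KD (small_comp (fun t : 1.-tuple N => [tuple i (thead t); g]) dF)
     (small_comp (fun _ : 1.-tuple N => p g) alphal))) => t.
rewrite -[RHS]/(_ - _) conj_pullback.
rewrite -[X in X + _ - _]/(_ - _) -[X in _ - (X + _)]/(_ - _).
by rewrite !pair_map2 -(conj_kernelE e) !(proj_kernel e) !subrK.
Qed.

Lemma small_extension (f : 1.-tuple N -> V) :
  small K (group_diff rhoN f) ->
  (forall g, pair_map (conj_kernel e g) (rhoG g) f = f) ->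
  exists (F : 1.-tuple G -> V) (alpha : 2.-tuple Gamma -> V),
    pull i F = f /\ small K (group_diff rhoG F - pull p alpha).
Proof.
move=> df f_inv; have [s [r [s1 sK rE]]] := normalized_section e.
have i_inj : injective i by case: e.
(* The additive bookkeeping of the final comparison; the permutation pairs every cancelling term
   with its opposite. *)
have cancel (a b c d u v k m n : V) :
    a + b - c - (d + a - u + v - k) + (d + m - n) - (b - v + m) =
    k - c - n + u.
  rewrite !opprD !opprK !addrA.
  rewrite [LHS](ACl (8 * 3 * 11 * 6 * (1 * 5) * (2 * 12) * (9 * 4) * (13 * 7)
    * (10 * 14)))%AC /=.
  by rewrite !subrr !addr0.
(* Normalization of [s] enters here: it makes the extension restrict to [f] exactly. *)
have ri x : r (i x) = x.
  apply: i_inj; apply: (mulIg (s 1%g)).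
  by rewrite -{1}(proj_kernel e x) rE s1 mulg1.
have rM x g : r (i x * g)%g = (x * r g)%g.
  apply: i_inj; apply: (mulIg (s (p g))); rewrite gmulfM -mulgA rE.
  by rewrite -(mul1g (p g)) -(proj_kernel e x) -gmulfM rE.
pose F1 g := f [tuple r g]; pose F (t : 1.-tuple G) := F1 (thead t).
pose A x g := group_diff rhoN f [tuple x; r g].
(* [A] is a value of the differential of [f], hence small uniformly in x and g. *)
have F1M x g : F1 (i x * g)%g = f [tuple x] + F1 g - A x g.
  rewrite /F1 /A rM group_diff1 kernel_act_trivial//.
  by rewrite opprD opprB [f [tuple x] + _]addrC addrACA subrr addr0 addrC subrK.
(* Invariance of [f], rewritten as g.f(x) = f(g x g^-1). *)
have fJ g x : rho (p g) (f [tuple x]) = f [tuple conj_kernel e g^-1%g x].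
  rewrite -[in RHS](f_inv g) /pair_map map_tuple1; congr (rho _ (f _)).
  apply/val_inj; congr [:: _]; apply: i_inj.
  by rewrite !conj_kernelE -conjgM mulVg conjg1.
(* The differential of [F] depends on its arguments only through [p] up to a small error, so [alpha]
   is its value on the chosen lifts. *)
exists F, (fun t => group_diff rhoG F (map_tuple s t)); split.
  by apply/funext => t; rewrite (tuple1E t) pair_map1 /F /F1 ri.
(* For t = (g, h), write g = x g' and h = y h' with g' = s (p g) and
   h' = s (p h); then gh = x y' g'h' for y' = g' y g'^-1, and invariance gives
   g.f(y) = f(y'). *)
pose x (t : 2.-tuple G) := r (thead t).
pose y (t : 2.-tuple G) := r (thead (behead_tuple t)).
pose g' (t : 2.-tuple G) := s (p (thead t)).
pose h' (t : 2.-tuple G) := s (p (thead (behead_tuple t))).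
pose y' t := conj_kernel e (g' t)^-1%g (y t).
(* These four errors come from expanding F(gh), g.F(h) and F(g) by [F1M], and f(x y') by the
   near-additivity of [f]. *)
apply: eq_small (smallD KD (smallB KD (smallB KD
  (small_comp (fun t => [tuple x t * y' t; r (g' t * h' t)]%g) df)
  (small_isometry (A := fun t : 2.-tuple G => rhoG (thead t))
    (fun t => norm_act rhoG (thead t))
    (small_comp (fun t => [tuple y t; r (h' t)]) df)))
  (small_comp (fun t => [tuple x t; r (g' t)]) df))
  (small_comp (fun t => [tuple x t; y' t]) df)) => t.
have [g [k tE]] := tuple2E t.
have gE : g = (i (x t) * g' t)%g by rewrite /x /g' rE tE.
have kE : k = (i (y t) * h' t)%g by rewrite /y /h' rE tE.
have gkE : (g * k = i (x t * y' t) * (g' t * h' t))%g.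
  rewrite gE kE gmulfM conj_kernelE -!mulgA; congr (_ * _)%g.
  by rewrite invgK mulKg.
have f_y' : rho (p g) (f [tuple y t]) = f [tuple y' t].
  by rewrite gE gmulfM proj_kernel// mul1g fJ.
have fM : f [tuple x t * y' t]%g =
    f [tuple x t] + f [tuple y' t] - group_diff rhoN f [tuple x t; y' t].
  rewrite group_diff1 kernel_act_trivial// opprD opprB [f [tuple x t] + _]addrC.
  by rewrite addrACA subrr addr0 addrC subrK.
have -> : (group_diff rhoG F - pull p (fun t => group_diff rhoG F
    (map_tuple s t))) t =
    (rho (p g) (F1 k) - F1 (g * k)%g + F1 g) -
    (rho (p g) (F1 (h' t)) - F1 (g' t * h' t)%g + F1 (g' t)).
  rewrite -[LHS]/(_ - _) {1}tE group_diff1; congr (_ - _).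
  by rewrite tE /pair_map !map_tuple2 group_diff1 /= sK.
have -> : rho (p g) (F1 k) = f [tuple y' t] + rho (p g) (F1 (h' t)) -
    rho (p g) (A (y t) (h' t)) by rewrite kE F1M linearB linearD f_y'.
have -> : p g = p (thead t) by rewrite tE.
rewrite gkE [in F1 g]gE !F1M fM; apply/esym; exact: cancel.
Qed.

End SmallExtension.

(** * Homogenization *)

Section Homogenization.
Context {R : realType} {H : groupType}.

(** Squaring n times multiplies the norm of [f x] by 2^n, which cannot stay below [M] unless it is
    0. *)
Lemma doubling_bounded_eq0 (V : normedModType R) (f : H -> V) (M : R) :
  (forall x, f (x * x)%g = 2 *: f x) -> (forall x, `|f x| <= M) ->
  forall x, f x = 0.
Proof.
move=> f2 fM x; apply/eqP; rewrite -normr_eq0 eq_le normr_ge0 andbT leNgt.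
apply/negP => fx0.
have bound n y : `|f y| * 2 ^+ n <= M.
  elim: n y => [|n IHn] y; first by rewrite mulr1.
  have := IHn (y * y)%g; rewrite f2 normrZ (ger0_norm (ler0n _ 2)).
  by rewrite [2 * _]mulrC -mulrA -exprS.
have M0 : 0 <= M / `|f x| by rewrite divr_ge0// (le_trans _ (fM x)).
(* An integer [n] above M / |f x| would have to exceed 2^n. *)
have /(le_lt_trans _) := archi_boundP M0; set n := Num.bound _ => /(_ (2 ^+ n)).
have Mn : 2 ^+ n <= M / `|f x| by rewrite ler_pdivlMr// mulrC.
by move=> /(_ Mn); rewrite -natrX ltr_nat ltnNge ltnW// ltn_expl.
Qed.

Lemma homogenization (V : completeNormedModType R) (f : H -> V) (M : R) :
  (forall x y, `|f y - f (x * y)%g + f x| <= M) ->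
  exists2 h : H -> V, forall x, `|h x - f x| <= M
                    & forall x, h (x * x)%g = 2 *: h x.
Proof.
move=> fM; pose sq (y : H) := (y * y)%g.
pose u x n := 2^-1 ^+ n *: f (iter n sq x).
(* Consecutive terms differ by 2^-(n+1) (f(yy) - 2 f(y)) with y = x^(2^n), and the hypothesis at
   (y,y) bounds the bracket by [M]. *)
have u_tel x n : `|telescope (u x) n| <= geometric (M / 2) 2^-1 n.
  rewrite /telescope /u /geometric /=; set y := iter n sq x.
  rewrite exprSr -scalerA -scalerBr normrZ ger0_norm ?exprn_ge0 ?invr_ge0//.
  rewrite mulrC ler_wpM2r ?exprn_ge0 ?invr_ge0//.
  have two0 : 2 != 0 :> R by rewrite pnatr_eq0.
  rewrite -[X in _ - X](scalerK two0) -scalerBr normrZ.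
  rewrite ger0_norm ?invr_ge0// mulrC ler_wpM2r ?invr_ge0//.
  by rewrite distrC scaler_nat mulr2n addrAC; exact: fM.
have half1 : `|2^-1 : R| < 1 by rewrite ger0_norm ?invr_ge0// invf_lt1// ltr1n.
have M0 : 0 <= M by rewrite (le_trans _ (fM 1%g 1%g)).
have cvgn_tel x : cvgn [normed series (telescope (u x))].
  apply: (@series_le_cvg _ _ (geometric (M / 2) 2^-1)).
  - by move=> n; exact: normr_ge0.
  - by move=> n; rewrite /= mulr_ge0 ?divr_ge0 ?exprn_ge0 ?invr_ge0.
  - exact: u_tel.
  - exact: is_cvg_geometric_series.
(* The limit of [u x], as its initial term plus the sum of its increments. Completeness turns
   absolute convergence of that series into convergence. *)
pose h x := f x + limn (series (telescope (u x))).
have uh x : u x @ \oo --> h x.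
  rewrite (_ : u x = fun n => f x + series (telescope (u x)) n).
    by apply: cvgD; [exact: cvg_cst | exact: normed_cvg].
  apply/funext => n; rewrite -[f x]scale1r -[f x]/(f (iter 0 sq x)).
  by rewrite -eq_sum_telescope.
exists h => x.
  rewrite /h addrC addKr (le_trans (lim_series_norm (cvgn_tel x)))//.
  apply: limr_le => //; apply: nearW => n /=.
  (* The full geometric series sums to (M/2) / (1 - 1/2) = M. *)
  apply: le_trans (_ : series (geometric (M / 2) 2^-1) n <= _).
    by apply: ler_sum => k _; exact: u_tel.
  have half0 : 0 < 2^-1 :> R by rewrite invr_gt0.
  have M20 : 0 <= M / 2 by rewrite divr_ge0.
  apply: le_trans (geometric_le_lim _ M20 half0 half1) _.
  by rewrite [X in X - _](splitr 1) div1r addrK invrK mulfVK// pnatr_eq0.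
(* Starting from the square of x shifts the sequence by one step and doubles it. *)
have u2 : u (x * x)%g @ \oo --> 2 *: h x.
  rewrite (_ : u (x * x)%g = fun n => 2 *: u x n.+1).
    by apply: cvgZl_tmp; rewrite (cvg_shiftS (u x)).
  apply/funext => n; rewrite /u iterSr exprS scalerA mulrA.
  by rewrite mulfV ?pnatr_eq0// mul1r.
exact: (cvg_unique _ (uh (x * x)%g) u2).
Qed.

End Homogenization.

(** * The two five-term sequences *)

Section ModSmall.
Context {R : realType} {V : normedModType R} (K : set R).
Hypotheses (K0 : K 0) (KD : forall a b, K a -> K b -> K (a + b)).

(** Presents [C] as the quotient by small cochains up to isomorphism, so that the group complex
    itself and the quotient by bounded cochains are both instances. *)
Definition is_mod_small (H : groupType) (sigma : action H V)
    (C : cochain_complex R) (pi : cochain_map (group_complex sigma) C) : Prop :=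
  forall n, (forall c, exists f, pi n f = c) /\
            (forall f, pi n f = 0 <-> small K (f : n.-tuple H -> V)).

Lemma mod_small_eq (H : groupType) (sigma : action H V) (C : cochain_complex R)
    (pi : cochain_map (group_complex sigma) C) n (f h : n.-tuple H -> V) :
  is_mod_small pi -> pi n f = pi n h <-> small K (f - h).
Proof.
move=> /(_ n)[_ /(_ (f - h))]; rewrite linearB => piP.
split=> [fh | /piP/eqP]; first by apply/piP; rewrite fh subrr.
by rewrite subr_eq0 => /eqP.
Qed.

Context {N G Gamma : groupType}.
Context {i : {multiplicative N -> G}} {p : {multiplicative G -> Gamma}}.
Hypothesis e : short_exact i p.
Variable rho : isometric_action Gamma V.

Local Notation rhoG := (pullback_isometric p rho).
Local Notation rhoN := (pullback_isometric i rhoG).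

Context {CN CG CQ : cochain_complex R}.
Context {piN : cochain_map (group_complex rhoN) CN}.
Context {piG : cochain_map (group_complex rhoG) CG}.
Context {piQ : cochain_map (group_complex rho) CQ}.
Hypotheses (piNP : is_mod_small piN) (piGP : is_mod_small piG).
Hypothesis piQP : is_mod_small piQ.
Variables (infl : cochain_map CQ CG) (restr : cochain_map CG CN).
Variable conj : G -> cochain_map CN CN.
Hypothesis inflE : forall n f,
  infl n (piQ n f) = piG n (pullback_chain_map p rho n f).
Hypothesis restrE : forall n f,
  restr n (piG n f) = piN n (pullback_chain_map i rhoG n f).
Hypothesis conjE : forall g n f,
  conj g n (piN n f) = piN n (conj_chain_map e rho g n f).
Variable res : {linear cohomology CG 1 -> invariant_cohomology conj 1}.
Hypothesis val_res : forall c, val (res c) = cohomology_map restr 1 c.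
(** The two cases diverge here: for K = {0} the cochain is already invariant, while modulo bounded
    cochains homogenization, and hence completeness, is required. *)
Hypothesis invariant_lift : forall f : 1.-tuple N -> V,
  small K (group_diff rhoN f) ->
  (forall g, small K (pair_map (conj_kernel e g) (rhoG g) f - f)) ->
  exists2 h, small K (h - f) &
    forall g, pair_map (conj_kernel e g) (rhoG g) h = h.

Lemma mod_small_five_term :
  exists tau : {linear invariant_cohomology conj 1 -> cohomology CQ 2},
    is_connecting infl restr tau /\
    five_term_exact (cohomology_map infl 1) res tau (cohomology_map infl 2).
Proof.
have repQ n c : exists f, piQ n f = c by case: (piQP n).
have repG n c : exists f, piG n f = c by case: (piGP n).
have repN n c : exists f, piN n f = c by case: (piNP n).
have zeroQ n f : piQ n f = 0 <-> small K f by case: (piQP n).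
have zeroG n f : piG n f = 0 <-> small K f by case: (piGP n).
have zeroN n f : piN n f = 0 <-> small K f by case: (piNP n).
apply: abstract_five_term => //.
- move=> n; apply: raddf_inj => c; have [f <-] := repQ n c.
  by rewrite /= inflE => /zeroG/(small_pullback_inj e)/zeroQ.
- move=> v; have [f <-] := repG _ v; exists (piQ 0 (fun=> f [tuple])).
  rewrite inflE; congr (piG 0 _); apply/funext => t.
  by rewrite /= /pair_map (tuple0 t).
- move=> v; have [f <-] := repN _ v; rewrite -cochain_map_diff.
  rewrite -(linear0 (piN 1)); congr (piN 1 _); apply/funext => t.
  by rewrite (tuple1E t) /= group_diff0 kernel_act_trivial// subrr.
- move=> F' alpha'; have [F <-] := repG _ F'; have [alpha <-] := repQ _ alpha'.
  rewrite restrE => /zeroN F0; rewrite -cochain_map_diff => /zeroQ dalpha.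
  rewrite -cochain_map_diff inflE => /(mod_small_eq _ _ piGP) dF.
  have [b bF] := small_descent e KD F0 dalpha dF.
  by exists (piQ 1 b); rewrite inflE; apply/(mod_small_eq _ _ piGP).
- move=> b'; have [b <-] := repQ _ b'; rewrite inflE restrE.
  by rewrite -cochain_map_diff => /zeroN/(small_constant e)/zeroN.
- move=> f' df' f'_inv; have [f0 f0E] := repN _ f'; subst f'.
  rewrite -cochain_map_diff in df'; move/zeroN in df'.
  (* The representative [f0] is invariant only up to an error depending on g; [f] is exactly
     invariant and has the same image in [CN]. *)
  have [|f f_f0 f_inv] := invariant_lift df'.
    by move=> g; apply/(mod_small_eq _ _ piNP); rewrite -conjE.
  have {}f_f0 : piN 1 f = piN 1 f0 by apply/(mod_small_eq _ _ piNP).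
  have df : small K (group_diff rhoN f).
    apply/zeroN; rewrite [LHS]cochain_map_diff f_f0 -cochain_map_diff.
    exact/zeroN.
  have [F [alpha [Ff dF]]] := small_extension KD df f_inv.
  exists (piG 1 F), (piQ 2 alpha); rewrite restrE inflE -cochain_map_diff.
  by rewrite -f_f0 -Ff; split=> //; apply/(mod_small_eq _ _ piGP).
- move=> alpha'; have [alpha <-] := repQ _ alpha'.
  have [b bP] := small_normalization e rho K0 alpha.
  exists (piQ 1 b); rewrite -cochain_map_diff -linearB inflE restrE.
  exact/zeroN.
- move=> F' alpha' g; have [F <-] := repG _ F'.
  have [alpha <-] := repQ _ alpha'.
  rewrite -cochain_map_diff => /zeroQ dalpha.
  rewrite inflE restrE => /zeroN alpha_N.
  rewrite -cochain_map_diff => /(mod_small_eq _ _ piGP) dF.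
  rewrite restrE conjE; apply/(mod_small_eq _ _ piNP).
  exact: small_restr_conj dalpha alpha_N dF.
Qed.

End ModSmall.

(** Conjugation is a homomorphism, so the defect of invariance of the homogenized [h] doubles under
    squaring. It is bounded for each fixed g, hence zero. *)
Lemma bounded_invariant_lift (R : realType) (N G Gamma : groupType)
    (i : {multiplicative N -> G}) (p : {multiplicative G -> Gamma})
    (e : short_exact i p) (V : completeNormedModType R)
    (rho : isometric_action Gamma V) (f : 1.-tuple N -> V) :
  let rhoG := pullback_isometric p rho in
  small setT (group_diff (pullback_isometric i rhoG) f) ->
  (forall g, small setT (pair_map (conj_kernel e g) (rhoG g) f - f)) ->
  exists2 h, small setT (h - f) &
    forall g, pair_map (conj_kernel e g) (rhoG g) h = h.
Proof.
move=> rhoG [M _ df] f_inv.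
have [|h hf h2] := @homogenization R N V (fun x => f [tuple x]) M.
  move=> x y; have := df [tuple x; y].
  by rewrite group_diff1 kernel_act_trivial.
exists (fun t => h (thead t)) => [|g].
  by exists M => // t; rewrite -[X in `|X|]/(_ - _) [t in f t]tuple1E.
have [M' _ fM'] := f_inv g.
pose d x := rho (p g) (h (conj_kernel e g x)) - h x.
apply/funext => t; rewrite (tuple1E t) /pair_map map_tuple1; apply/eqP.
rewrite -subr_eq0; apply/eqP.
(* Each passage between [h] and [f] costs [M], and the defect of [f] at g costs [M']. *)
apply: (@doubling_bounded_eq0 R N V d (M + M' + M)) => x; rewrite /d.
  by rewrite conj_kernelM !h2 linearZ scalerBr.
have -> : rho (p g) (h (conj_kernel e g x)) - h x =
    rho (p g) (h (conj_kernel e g x) - f [tuple conj_kernel e g x]) +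
    (rho (p g) (f [tuple conj_kernel e g x]) - f [tuple x]) +
    (f [tuple x] - h x) by rewrite linearB !addrA !subrK.
rewrite (le_trans (ler_normD _ _))// lerD//; last by rewrite distrC; exact: hf.
rewrite (le_trans (ler_normD _ _))// lerD//.
  by rewrite (norm_act rho); exact: hf.
by have := fM' [tuple x]; rewrite -[X in `|X|]/(_ - _) /pair_map map_tuple1.
Qed.

Definition identity_cochain_map (R : pzRingType) (C : cochain_complex R) :
    cochain_map C C :=
  @ChainMap R C C (fun n => idfun) (fun n x => erefl).

Lemma group_complex_mod_small (R : realType) (H : groupType)
    (V : normedModType R) (sigma : action H V) :
  is_mod_small [set 0 : R] (identity_cochain_map (group_complex sigma)).
Proof.
move=> n; split=> [c | f]; first by exists c.
split=> [f0 | [_ -> f0]].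
  by exists 0 => // t; rewrite (f0 : f = 0) normr0.
by apply/funext => t; apply/eqP; rewrite -normr_le0.
Qed.

Lemma mod_bounded_complex_mod_small (R : realType) (H : groupType)
    (V : normedModType R) (sigma : isometric_action H V) :
  is_mod_small setT (quotient_complex_proj (bounded_subcomplex sigma)).
Proof.
move=> n; split=> [c | f]; first by exists (repr c); exact: quotient_projK.
rewrite -(linear0 (quotient_complex_proj (bounded_subcomplex sigma) n)).
split=> [/quotient_projP | [M _ fM]].
  by rewrite subr0 => /bounded_cochainP[M fM]; exists M.
by apply/quotient_projP; rewrite subr0; apply/bounded_cochainP; exists M.
Qed.

(** * The ordinary sequence and the sequence modulo bounded cochains *)

Section FiveTermSequences.
Context {R : realType} {N G Gamma : groupType}.
Context {i : {multiplicative N -> G}} {p : {multiplicative G -> Gamma}}.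
Hypothesis e : short_exact i p.

Lemma group_five_term (V : normedModType R) (rho : isometric_action Gamma V) :
  exists tau : {linear invariant_group_cohomology e rho 1 ->
                       group_cohomology rho 2},
    is_transgression e rho tau /\
    five_term_exact (inflation p rho 1) (restriction e rho) tau
      (inflation p rho 2).
Proof.
have addK (a b : R) : [set 0] a -> [set 0] b -> [set 0] (a + b).
  by move=> -> ->; rewrite /= addr0.
apply: (mod_small_five_term _ addK (group_complex_mod_small _)
  (group_complex_mod_small _) (group_complex_mod_small _)
  (infl := pullback_chain_map p rho)
  (restr := pullback_chain_map i (pullback_isometric p rho))
  (conj := conj_chain_map e rho) _ _ _ (res := restriction e rho)) => //.
move=> f _ f_inv; exists f; first by rewrite subrr; exact: small0.
(* With bound 0 the invariance of [f] is an equality. *)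
move=> g; have [_ -> f_inv_g] := f_inv g.
apply/funext => t; apply/eqP; rewrite -subr_eq0 -normr_le0.
exact: f_inv_g.
Qed.

Lemma mod_bounded_five_term (V : completeNormedModType R)
    (rho : isometric_action Gamma V) :
  exists tau : {linear invariant_mod_bounded_cohomology e rho 1 ->
                       mod_bounded_cohomology rho 2},
    is_connecting (mod_bounded_pullback_chain_map p rho)
      (mod_bounded_pullback_chain_map i (pullback_isometric p rho)) tau /\
    five_term_exact (mod_bounded_inflation p rho 1)
      (mod_bounded_restriction e rho) tau (mod_bounded_inflation p rho 2).
Proof.
apply: (mod_small_five_term _ _ (mod_bounded_complex_mod_small _)
  (mod_bounded_complex_mod_small _) (mod_bounded_complex_mod_small rho)
  (infl := mod_bounded_pullback_chain_map p rho)
  (restr := mod_bounded_pullback_chain_map i (pullback_isometric p rho))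
  (conj := mod_bounded_conj_chain_map e rho) _ _ _
  (res := mod_bounded_restriction e rho)) => //.
- by move=> n f; exact: quotient_mapE.
- by move=> n f; exact: quotient_mapE.
- by move=> g n f; exact: quotient_mapE.
- exact: bounded_invariant_lift.
Qed.

End FiveTermSequences.

Theorem theorem1p5 (R : realType) (N G Gamma : groupType)
    (i : {multiplicative N -> G}) (p : {multiplicative G -> Gamma})
    (e : short_exact i p)
    (V : completeNormedModType R) (rho : isometric_action Gamma V) :
  exists tau : {linear invariant_group_cohomology e rho 1 ->
                       group_cohomology rho 2},
  [/\ is_transgression e rho tau,
      five_term_exact (inflation p rho 1) (restriction e rho)
        tau (inflation p rho 2) &
      exists tau_b : {linear invariant_mod_bounded_cohomology e rho 1 ->
                             mod_bounded_cohomology rho 2},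
        five_term_exact (mod_bounded_inflation p rho 1)
          (mod_bounded_restriction e rho)
          tau_b (mod_bounded_inflation p rho 2) /\
        [/\ forall c, to_mod_bounded (pullback_isometric p rho) 1
                        (inflation p rho 1 c) =
                      mod_bounded_inflation p rho 1 (to_mod_bounded rho 1 c),
            forall c, invariant_to_mod_bounded e rho 1 (restriction e rho c) =
                      mod_bounded_restriction e rho
                        (to_mod_bounded (pullback_isometric p rho) 1 c),
            forall c, to_mod_bounded rho 2 (tau c) =
                      tau_b (invariant_to_mod_bounded e rho 1 c) &
            forall c, to_mod_bounded (pullback_isometric p rho) 2
                        (inflation p rho 2 c) =
                      mod_bounded_inflation p rho 2 (to_mod_bounded rho 2 c)]].
Proof.
have [tau [tauP tau_exact]] := group_five_term e rho.
have [tau_b [tau_bP tau_b_exact]] := mod_bounded_five_term e rho.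
exists tau; split=> //; exists tau_b; split=> //; split.
- by apply: cohomology_map_square => x; exact/esym/quotient_mapE.
- move=> c; apply/val_inj.
  by apply: cohomology_map_square => x; exact/esym/quotient_mapE.
(* The square with the connecting maps: data (F, alpha) for c project to connecting data modulo
   bounded cochains, and [tau_b] may be computed from any such data. *)
- move=> c; have [[F [alpha cFa]] tauE] := tauP c.
  rewrite (tauE _ _ cFa) [LHS]cohomology_mapE; apply/esym.
  case: cFa => -[f [cf Ff]] dF.
  have [_] := tau_bP (invariant_to_mod_bounded e rho 1 c).
  apply; split.
    exists (cocycle_map (quotient_complex_proj (bounded_subcomplex
      (pullback_isometric i (pullback_isometric p rho)))) 1 f).
    split; first by rewrite /= cf; exact: cohomology_mapE.
    by rewrite [RHS]/= -Ff; exact: quotient_mapE.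
  rewrite -(cochain_map_diff (quotient_complex_proj
    (bounded_subcomplex (pullback_isometric p rho)))).
  by rewrite [X in _ X = _]dF; exact/esym/quotient_mapE.
- by apply: cohomology_map_square => x; exact/esym/quotient_mapE.
Qed.
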